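(* Let $\mathcal B$ be a real Banach space and let $(T_t)_{t\ge0}$ be a $\mathcal C_0$-semigroup on $\mathcal B$ such that, for some $r$, $T_t$ is compact for all $t\ge r$; let $L$ be its infinitesimal generator. Assume that $\operatorname{Re}(\lambda)<0$ for every $\lambda\in P\sigma(L)$. Then $(T_t)_{t\ge0}$ is exponentially stable, i.e. for every $\xi\in\mathcal B$, $$\limsup_{t\to\infty}\frac1t\log\|T_t\xi\|_{\mathcal B}\le\lambda_1<0,\qquad\text{where}\quad\lambda_1=\max\{\operatorname{Re}(\lambda):\lambda\in P\sigma(L)\}$$ (with the maximum read as $-\infty$ if $P\sigma(L)=\emptyset$).
   Context: $P\sigma(L)$ is the point spectrum of $L$, i.e. the set of $\lambda\in\mathbb C$ for which $\lambda I-L$ (on the complexification of $\mathcal B$) is not injective. *)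

(* Defs.v *)
From HB Require Import structures.
From mathcomp Require Import all_boot all_order all_algebra.
From mathcomp Require Import all_classical all_reals all_analysis.
From mathcomp Require Import complex.
Import Order.TTheory GRing.Theory Num.Theory.
Import numFieldNormedType.Exports.

Set Implicit Arguments.
Unset Strict Implicit.
Unset Printing Implicit Defensive.

Local Open Scope classical_set_scope.
Local Open Scope complex_scope.
Local Open Scope ring_scope.

(* Only the values T t with 0 <= t are constrained, so that T stands for a
   family indexed by [0, +oo[.  As 0^'+ is the filter of punctured right
   neighbourhoods of 0, the last clause is the strong continuity at 0. *)
Record C0_semigroup (R : realType) (B : normedModType R) (T : R -> B -> B) :
    Prop := {
  C0_linear : forall t, 0 <= t -> linear (T t) ;
  C0_continuous : forall t, 0 <= t -> continuous (T t) ;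
  C0_id : forall x, T 0 x = x ;
  C0_add : forall s t, 0 <= s -> 0 <= t -> forall x, T (s + t) x = T s (T t x) ;
  C0_strong : forall x, T t x @[t --> 0^'+] --> x }.

Definition compact_operator (R : realType) (B : normedModType R)
    (f : B -> B) : Prop :=
  linear f /\ forall A : set B, bounded_set A -> precompact (f @` A).

(* An unbounded operator: the values of op_fun outside of op_dom are
   irrelevant. *)
Record unbounded_operator (V : Type) := UnboundedOperator {
  op_dom : set V ;
  op_fun : V -> V }.

Definition generator (R : realType) (B : normedModType R) (T : R -> B -> B) :
    unbounded_operator B :=
  let quotient (x : B) (h : R) := h^-1 *: (T h x - x) in
  {| op_dom := [set x | cvg (quotient x h @[h --> 0^'+])] ;
     op_fun := fun x => lim (quotient x h @[h --> 0^'+]) |}.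

(* The pair (x, y) stands for x + i y.  The definition is an alias, because
   B * B already carries a structure of R-module. *)
Definition complexification (R : rcfType) (B : lmodType R) : Type :=
  (B * B)%type.

Section ComplexificationLmodule.
Variables (R : rcfType) (B : lmodType R).
Local Notation BC := (complexification B).

HB.instance Definition _ := GRing.Zmodule.copy BC (B * B)%type.

Definition complexification_scale (l : R[i]) (z : BC) : BC :=
  (complex.Re l *: z.1 - complex.Im l *: z.2,
   complex.Re l *: z.2 + complex.Im l *: z.1).

Lemma complexification_scaleA a b z :
  complexification_scale a (complexification_scale b z) =
  complexification_scale (a * b) z.
Proof.
case: a b z => [a1 a2] [b1 b2] [x y]; congr pair => /=.
- rewrite !scalerDr !scalerN !scalerA scalerBl scalerDl !opprD.
  by rewrite [in LHS](addrC (- (_ *: y))) addrACA.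
- rewrite !scalerDr !scalerN !scalerA scalerBl scalerDl.
  by rewrite [in LHS](addrC (_ *: x) (- _)) addrACA.
Qed.

Lemma complexification_scale1 : left_id 1 complexification_scale.
Proof.
by case=> x y; rewrite /complexification_scale /= !scale1r !scale0r subr0 addr0.
Qed.

Lemma complexification_scaleDr : right_distributive complexification_scale +%R.
Proof.
case=> [a1 a2] [x y] [x' y']; congr pair => /=.
- by rewrite !scalerDr opprD addrACA.
- by rewrite !scalerDr addrACA.
Qed.

Lemma complexification_scaleDl z :
  {morph complexification_scale^~ z : a b / a + b}.
Proof.
case: z => x y [a1 a2] [b1 b2]; congr pair => /=.
- by rewrite !scalerDl opprD addrACA.
- by rewrite !scalerDl addrACA.
Qed.

HB.instance Definition _ := GRing.Zmodule_isLmodule.Build R[i] BC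
  complexification_scaleA complexification_scale1
  complexification_scaleDr complexification_scaleDl.

End ComplexificationLmodule.

Definition complexified_operator (R : rcfType) (B : lmodType R)
    (L : unbounded_operator B) : unbounded_operator (complexification B) :=
  {| op_dom := [set z | op_dom L z.1 /\ op_dom L z.2] ;
     op_fun := fun z => (op_fun L z.1, op_fun L z.2) |}.

Definition point_spectrum (R : rcfType) (B : lmodType R)
    (L : unbounded_operator B) : set R[i] :=
  let LC := complexified_operator L in
  [set l | ~ set_inj (op_dom LC) (fun z => l *: z - op_fun LC z)].

(* The maximum is required to be attained, unless S is empty. *)
Definition is_emax (R : realType) (S : set R) (m : \bar R) : Prop :=
  (S = set0 /\ m = -oo%E) \/ (exists2 x, S x /\ ubound S x & m = x%:E).

(* Main.v *)
Require Import Defs.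
From HB Require Import structures.
From mathcomp Require Import all_boot all_order all_algebra.
From mathcomp Require Import all_classical all_reals all_analysis.
From mathcomp Require Import separable cyclotomic complex zify ring lra.
From mathcomp Require cyclic.
Import Order.TTheory GRing.Theory Num.Theory.
Import numFieldNormedType.Exports.

Local Open Scope classical_set_scope.
Local Open Scope ring_scope.

(** The idea is that the growth bound [omega] of the semigroup, the infimum of
    the [w] such that the norm of [T_t] is at most [C exp (w t)], equals the
    maximum of the real parts of the eigenvalues of the generator.

    One inequality is general: an eigenvector [z] for [l] satisfies
    [T_t z = exp (l t) z] ([eigenvector_orbit]), so [Re l] is at most every
    growth exponent ([Re_eigenvalue_le_growth_exponent]). In particular, if
    there are arbitrarily negative growth exponents, then there is no eigenvalue
    and every orbit decays faster than any exponential.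

    The converse uses compactness. Suppose that [omega] is finite and fix a
    time [t0 > 0] such that [T_t0] is compact. The spectral radius of [T_t0] is
    [exp (omega t0)]. Were the resolvents of [T_t0] bounded outside the circle
    of that radius, the powers of [T_t0] would decay faster than their growth
    bound permits; this is shown without holomorphic functions, by averaging finite
    sums over roots of unity ([orbit_bound_of_bounded_below]). Hence there are
    approximate eigenvectors near the circle
    ([approximate_peripheral_eigenvector]), and compactness turns them into an
    eigenvector of [T_t0] ([peripheral_eigenvector]).

    This eigenvector belongs to [T_t0] alone. Successive square roots give
    eigenvectors common to [T_t0] and to the operators at the times
    [t0 / 2 ^ m], and a second use of compactness yields a vector [w] on which
    every [T_t] acts as a scalar [c t] ([common_eigenvector]). The function [c]
    is a continuous character, hence differentiable at 0
    ([complex_character_right_derivable]), so [w] is an eigenvector of the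
    generator, and comparing moduli at [t0] shows that the real part of its
    eigenvalue is at least [omega] ([peripheral_eigenvalue]). So the maximum
    exists and equals [omega], and the upper limit is at most [w] for every
    growth exponent [w] ([limf_esup_le_growth_exponent]), hence at most
    [omega]. *)

Import ComplexField.Normc.

Set Implicit Arguments.
Unset Strict Implicit.
Unset Printing Implicit Defensive.

(** * The complexification as a normed space *)

Section ComplexNorm.
Variables (R : realType) (B : normedModType R).
Implicit Types (z w : complexification B) (l : R[i]).

(** The sum norm of the real product space: it induces the right topology and
    makes the complexification of a real operator satisfy the same bounds as
    the operator. *)
Definition cnorm z : R := `|z.1| + `|z.2|.

Lemma cnorm_ge0 z : 0 <= cnorm z.
Proof. exact: addr_ge0. Qed.

Lemma cnorm_eq0 z : cnorm z = 0 -> z = 0.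
Proof.
case: z => x y /eqP; rewrite /cnorm paddr_eq0//= !normr_eq0.
by move=> /andP[/eqP-> /eqP->].
Qed.

Lemma cnorm0 : cnorm (0 : complexification B) = 0.
Proof. by rewrite /cnorm !normr0 addr0. Qed.

Lemma cnorm_gt0 z : z != 0 -> 0 < cnorm z.
Proof.
move=> z0; rewrite lt_neqAle cnorm_ge0 andbT eq_sym.
by apply: contra_neq z0; exact: cnorm_eq0.
Qed.

Lemma cnorm1_neq0 z : cnorm z = 1 -> z != 0.
Proof.
move=> z1; apply/eqP => z0.
by move: z1; rewrite z0 cnorm0 => /esym/eqP; rewrite oner_eq0.
Qed.

Lemma cnormN z : cnorm (- z) = cnorm z.
Proof. by rewrite /cnorm /= !normrN. Qed.

Lemma ler_cnormD z w : cnorm (z + w) <= cnorm z + cnorm w.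
Proof. by rewrite /cnorm /= addrACA lerD// ler_normD. Qed.

Lemma ler_cnormB z w : cnorm (z - w) <= cnorm z + cnorm w.
Proof. by rewrite -(cnormN w) ler_cnormD. Qed.

Lemma ler_cnorm_sum n (f : 'I_n -> complexification B) :
  cnorm (\sum_(i < n) f i) <= \sum_(i < n) cnorm (f i).
Proof.
elim/big_ind2: _ => [|z a w b za wb|//]; first by rewrite cnorm0.
exact: le_trans (ler_cnormD _ _) (lerD za wb).
Qed.

Lemma normc_ge0 l : 0 <= normc l.
Proof. by case: l => a b; exact: sqrtr_ge0. Qed.

Lemma normr_Re_le l : `|complex.Re l| <= normc l.
Proof. by case: l => a b /=; rewrite -sqrtr_sqr ler_wsqrtr// lerDl sqr_ge0. Qed.

Lemma normr_Im_le l : `|complex.Im l| <= normc l.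
Proof. by case: l => a b /=; rewrite -sqrtr_sqr ler_wsqrtr// lerDr sqr_ge0. Qed.

Lemma normc_real (a : R) : normc (a%:C)%C = `|a|.
Proof. by rewrite /= expr0n addr0 sqrtr_sqr. Qed.

Lemma cnormZr (a : R) z : cnorm ((a%:C)%C *: z) = `|a| * cnorm z.
Proof.
case: z => x y; rewrite /cnorm /= !scale0r subr0 addr0 !normrZ.
by rewrite mulrDr.
Qed.

Lemma cnormMn (n : nat) z : cnorm (n%:R *: z) = n%:R * cnorm z.
Proof.
have -> : n%:R = ((n%:R : R)%:C)%C by rewrite rmorph_nat.
by rewrite cnormZr ger0_norm.
Qed.

(** [cnorm] is not homogeneous over the complex numbers. This bound and the
    next one replace homogeneity; the factor 2 is harmless, since only
    exponential rates and convergence matter. *)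
Lemma ler_cnormZ l z : cnorm (l *: z) <= 2 * normc l * cnorm z.
Proof.
case: z => x y; rewrite /cnorm /=.
have := normr_Re_le l; have := normr_Im_le l.
have := ler_normB (complex.Re l *: x) (complex.Im l *: y).
have := ler_normD (complex.Re l *: y) (complex.Im l *: x).
rewrite !normrZ; have := normr_ge0 x; have := normr_ge0 y.
nra.
Qed.

Lemma ler_normc_cnorm l z : normc l * cnorm z <= 2 * cnorm (l *: z).
Proof.
have [->|l0] := eqVneq l 0; first by rewrite normc0 mul0r mulr_ge0// cnorm_ge0.
have := ler_cnormZ l^-1 (l *: z).
rewrite scalerA mulVf// scale1r normcV.
have n0 : 0 < normc l.
  rewrite lt_neqAle normc_ge0 andbT eq_sym.
  by apply: contra_neq l0; exact: eq0_normc.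
move=> /(ler_wpM2l (ltW n0)) /le_trans; apply.
by rewrite mulrA mulrCA divff ?mulr1// gt_eqF.
Qed.

End ComplexNorm.

(** * Averaging over roots of unity *)

Lemma primitive_root_exists (F : numClosedFieldType) n :
  (n > 0)%N -> exists z : F, n.-primitive_root z.
Proof.
move=> n_gt0; have [rs Xn1E] := closed_field_poly_normal ('X^n - 1 : {poly F}).
rewrite (monicP _) ?monicXnsubC// scale1r in Xn1E.
have rs_sep : separable_poly (\prod_(z <- rs) ('X - z%:P)).
  by rewrite -Xn1E separable_Xn_sub_1// pnatr_eq0 -lt0n.
have /hasP[z _ ?] : has n.-primitive_root rs; last by exists z.
apply: cyclic.has_prim_root => //.
- by apply/allP => z; rewrite -root_prod_XsubC -Xn1E.
- by rewrite -separable_prod_XsubC.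
- by have := size_prod_XsubC rs id; rewrite -Xn1E size_XnsubC// => -[->].
Qed.

Lemma sum_primitive_root (F : fieldType) N (x : F) m :
  N.-primitive_root x ->
  \sum_(k < N) (x ^+ k) ^+ m = if (N %| m)%N then N%:R else 0.
Proof.
move=> px; under eq_bigr do rewrite -exprM mulnC exprM.
have [dvd|ndvd] := ifPn.
  have /eqP -> : x ^+ m == 1 by rewrite -(prim_order_dvd px).
  under eq_bigr do rewrite expr1n.
  by rewrite sumr_const card_ord.
have xm1 : x ^+ m - 1 != 0.
  by rewrite subr_eq0 -(prim_order_dvd px).
apply: (mulfI xm1); rewrite -subrX1 mulr0 exprAC (prim_expr_order px).
by rewrite expr1n subrr.
Qed.

Section WeightedOrbitSums.
Variables (V : zmodType) (A : {additive V -> V}).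

Lemma telescope_orbit_sum N z :
  \sum_(j < N) iter j A z - A (\sum_(j < N) iter j A z) = z - iter N A z.
Proof.
rewrite raddf_sum; elim: N => [|N IH]; first by rewrite !big_ord0 !subrr.
by rewrite !big_ord_recr /= opprD addrACA IH addrA subrK.
Qed.

(** The weighted sum plays the role of the square of the resolvent: applying
    [1 - A] twice to it leaves [z] up to terms in the [N]-th power of [A]. *)
Lemma telescope_weighted_orbit_sum N z :
  \sum_(j < N) iter j A z *+ j.+1 - A (\sum_(j < N) iter j A z *+ j.+1) =
  \sum_(j < N) iter j A z - iter N A z *+ N.
Proof.
rewrite raddf_sum; elim: N => [|N IH]; first by rewrite !big_ord0 mulr0n !subrr.
rewrite !big_ord_recr /= opprD addrACA IH (raddfMn A) (mulrS (iter N A z) N).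
by rewrite (addrC (iter N A z)) !addrA subrK.
Qed.

End WeightedOrbitSums.

Lemma iter_scale_fun (F : comNzRingType) (V : lmodType F)
    (A : {linear V -> V}) (a : F) j z :
  iter j (a \*: A) z = a ^+ j *: iter j A z.
Proof.
elim: j => [|j IH]; first by rewrite expr0 scale1r.
by rewrite !iterS IH /= linearZ/= scalerA -exprS.
Qed.

(** A discrete Cauchy formula: averaging over the [N]-th roots of unity picks
    out one coefficient of the weighted sum, which is how a bound on resolvents
    becomes a bound on a single power. The exponent [N - n] stands for [- n]. *)
Lemma average_weighted_orbit_sum (F : fieldType) (V : lmodType F)
    (A : {linear V -> V}) N (x : F) n z :
  N.-primitive_root x -> (n < N)%N ->
  \sum_(k < N) (x ^+ k) ^+ (N - n) *:
     \sum_(j < N) iter j (x ^+ k \*: A) z *+ j.+1 =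
  (iter n A z *+ n.+1) *+ N.
Proof.
move=> px nN.
under eq_bigr => k _.
  rewrite scaler_sumr; under eq_bigr => j _.
    rewrite iter_scale_fun -scalerMnr scalerA -exprD; over.
  over.
rewrite exchange_big /=.
under eq_bigr => j _.
  rewrite sumrMnl -scaler_suml (sum_primitive_root _ px); over.
rewrite (bigD1 (Ordinal nN))//= big1 ?addr0.
  by rewrite subnK ?(ltnW nN)// dvdnn scaler_nat mulrnAC.
move=> j; rewrite -val_eqE/= => jn.
rewrite ifF ?scale0r ?mul0rn//; apply/negP => /dvdnP[[|[|q]]].
- by have := ltn_ord j; lia.
- lia.
- by have := ltn_ord j; nia.
Qed.

Lemma normcX (R : rcfType) (l : R[i]) n : normc (l ^+ n) = normc l ^+ n.
Proof. by elim: n => [|n IH]; rewrite ?normc1// !exprS normcM IH. Qed.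

Lemma normc_primitive_root (R : realType) N (x : R[i]) k :
  N.-primitive_root x -> normc (x ^+ k) = 1.
Proof.
move=> px; apply/eqP.
rewrite -(@pexpr_eq1 _ (normc (x ^+ k)) N) ?normc_ge0 ?(prim_order_gt0 px)//.
by rewrite -normcX exprAC (prim_expr_order px) expr1n normc1.
Qed.

(** The lower bound says that the resolvents of [A] on the unit circle have norm
    at most [1 / delta]. The power series of the squared resolvent has
    coefficients [(n + 1) A ^ n], and the factor [n + 1] is the gain that makes
    the powers of [A] smaller than the resolvent bound alone would. The
    hypothesis on a single large [N] replaces the convergence of that series,
    so that finite sums over roots of unity suffice; the constant in the
    conclusion does not depend on [n] or [N]. *)
Lemma orbit_bound_of_bounded_below (R : realType) (B : normedModType R)
    (A : {linear complexification B -> complexification B}) (delta : R) N n :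
  0 < delta ->
  (forall x z, normc x = 1 -> delta * cnorm z <= cnorm (z - x *: A z)) ->
  (n < N)%N -> (forall z, N%:R * cnorm (iter N A z) <= cnorm z) ->
  forall z, n.+1%:R * cnorm (iter n A z) <=
            2 * (2 / delta ^+ 2 + 1 / delta) * cnorm z.
Proof.
move=> delta_gt0 below nN NA z.
have N_gt0 : (0 < N)%N by exact: leq_ltn_trans nN.
have NR_gt0 : 0 < N%:R :> R by rewrite ltr0n.
have [x px] := primitive_root_exists R[i] N_gt0.
have Az : cnorm (iter N A z) <= cnorm z.
  apply: le_trans (NA z); rewrite ler_peMl ?cnorm_ge0// ler1n//.
have sum_le k : cnorm (\sum_(j < N) iter j (x ^+ k \*: A) z *+ j.+1) <=
    (2 / delta ^+ 2 + 1 / delta) * cnorm z.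
  set Ak := x ^+ k \*: A; set P := \sum_(j < N) iter j Ak z.
  set D := \sum_(j < N) _.
  have xk1 : normc (x ^+ k) = 1 by exact: normc_primitive_root px.
  have AkN : iter N Ak z = iter N A z.
    by rewrite iter_scale_fun exprAC (prim_expr_order px) expr1n scale1r.
  have := below (x ^+ k) P xk1; have := below (x ^+ k) D xk1.
  have -> : D - x ^+ k *: A D = P - iter N Ak z *+ N.
    exact: telescope_weighted_orbit_sum.
  have -> : P - x ^+ k *: A P = z - iter N Ak z.
    exact: telescope_orbit_sum.
  have := ler_cnormB P (iter N Ak z *+ N).
  have := ler_cnormB z (iter N Ak z).
  rewrite -scaler_nat cnormMn AkN.
  have := NA z; move: Az.
  have : 0 < delta^-1 by rewrite invr_gt0.
  rewrite -exprVn; set d := delta^-1 => d_gt0.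
  set p := cnorm z; set q := cnorm (iter N A z).
  move=> qp Nq h1 h2 h3 h4.
  have P_le : cnorm P <= d * (2 * p).
    rewrite -ler_pdivrMl// /d invrK; lra.
  have D_le : cnorm D <= d * (cnorm P + p).
    rewrite -ler_pdivrMl// /d invrK; lra.
  apply: le_trans D_le _; rewrite -subr_ge0.
  have -> : (2 * d ^+ 2 + 1 * d) * p - d * (cnorm P + p) =
    d * (d * (2 * p) - cnorm P) by ring.
  by rewrite mulr_ge0 ?(ltW d_gt0)// subr_ge0.
rewrite -(ler_pM2l NR_gt0) -cnormMn -cnormMn !scaler_nat.
rewrite -(average_weighted_orbit_sum A z px nN).
apply: le_trans (ler_cnorm_sum _) _.
have term_le (k : 'I_N) : true -> cnorm ((x ^+ k) ^+ (N - n) *: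
    \sum_(j < N) iter j (x ^+ k \*: A) z *+ j.+1) <=
    2 * (2 / delta ^+ 2 + 1 / delta) * cnorm z.
  move=> _; apply: le_trans (ler_cnormZ _ _) _.
  rewrite normcX (normc_primitive_root _ px) expr1n mulr1 -mulrA.
  by rewrite ler_pM2l.
apply: le_trans (ler_sum _ term_le) _.
by rewrite sumr_const card_ord [leRHS]mulr_natl.
Qed.

(** * Growth of a strongly continuous semigroup *)

Lemma near0_rightP (R : realType) (P : set R) :
  (\forall h \near 0^'+, P h) <->
  exists2 eta : R, 0 < eta & forall h, 0 < h -> h < eta -> P h.
Proof.
split=> [/nbhs_ballP[eta /= eta_gt0 etaP]|[eta eta_gt0 etaP]].
  exists eta => // h h_gt0 h_lt; apply: etaP => //.
  by rewrite /ball/= sub0r normrN gtr0_norm.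
near=> h; apply: etaP; first by near: h; exact: nbhs_right_gt.
by near: h; exact: nbhs_right_lt.
Unshelve. all: by end_near. Qed.

Section Semigroup.
Variables (R : realType) (B : completeNormedModType R) (T : R -> B -> B).
Hypothesis T_semigroup : C0_semigroup T.

Lemma semigroup_linear t : 0 <= t -> exists f : {linear B -> B}, T t = f.
Proof.
move=> t_ge0.
pose f : {linear B -> B} := HB.pack (T t)
  (GRing.isLinear.Build _ _ _ _ _ (C0_linear T_semigroup t_ge0)).
by exists f.
Qed.

Lemma semigroupB t x y : 0 <= t -> T t (x - y) = T t x - T t y.
Proof. by move=> /semigroup_linear[f ->]; rewrite linearB. Qed.

Lemma semigroupD t x y : 0 <= t -> T t (x + y) = T t x + T t y.
Proof. by move=> /semigroup_linear[f ->]; rewrite linearD. Qed.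

Lemma semigroupZ t a x : 0 <= t -> T t (a *: x) = a *: T t x.
Proof. by move=> /semigroup_linear[f ->]; rewrite linearZ. Qed.

Lemma semigroup_iter t n x : 0 <= t -> T (n%:R * t) x = iter n (T t) x.
Proof.
move=> t_ge0; elim: n => [|n IH]; first by rewrite mul0r (C0_id T_semigroup).
rewrite iterS -IH -(C0_add T_semigroup) ?mulr_ge0//.
by rewrite -natr1 mulrDl mul1r addrC.
Qed.

Lemma semigroup_operator_bound t : 0 <= t ->
  exists M, forall x, `|T t x| <= M * `|x|.
Proof.
move=> t_ge0; have Tc := C0_continuous T_semigroup t_ge0.
move: (semigroup_linear t_ge0) Tc => [f ->] /linear_bounded_continuous.
move=> /linear_boundedP /pinfty_ex_gt0[M _ MP]; by exists M.
Qed.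

Lemma semigroup_near0 x (e : R) : 0 < e ->
  exists2 eta, 0 < eta &
    forall h, 0 <= h -> h < eta -> `|T h x - x| < e.
Proof.
move=> e_gt0; have /cvgrPdist_lt/(_ _ e_gt0) := @C0_strong _ _ _ T_semigroup x.
move=> /near0_rightP[eta eta_gt0 etaP]; exists eta => // h.
rewrite le_eqVlt => /predU1P[<-|h_gt0] h_lt.
  by rewrite (C0_id T_semigroup) subrr normr0.
by rewrite distrC; exact: etaP.
Qed.

(** Otherwise there are times tending to 0 whose operators have norms tending
    to infinity, while strong continuity bounds each of their orbits: this
    contradicts the uniform boundedness principle. *)
Lemma semigroup_bound_near0 :
  exists2 h, 0 < h &
    exists M, forall t x, 0 <= t -> t <= h -> `|T t x| <= M * `|x|.
Proof.
apply: contrapT => unbounded.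
have bad n : exists t, [/\ 0 <= t, t <= n.+1%:R^-1 &
    exists x, n%:R * `|x| < `|T t x|].
  apply: contrapT => nbad; apply: unbounded.
  exists n.+1%:R^-1; first by rewrite invr_gt0.
  exists n%:R => t x t_ge0 t_le; rewrite leNgt; apply/negP => Tx.
  by apply: nbad; exists t; split => //; exists x.
have [t tP] := choice bad.
have [||M MP] := @Banach_Steinhauss R B B (range (fun n => T (t n))) _ _ 1.
- move=> _ [n _ <-]; have [t_ge0 _ _] := tP n.
  split; last exact (C0_linear T_semigroup t_ge0).
  have [M MP] := semigroup_operator_bound t_ge0 => r.
  exists (`|M| * r) => x xr; apply: le_trans (MP x) _.
  apply: le_trans (ler_norm _) _; rewrite normrM normr_id.
  by rewrite ler_wpM2l.
- move=> x; have [eta eta_gt0 etaP] := semigroup_near0 x ltr01.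
  (* from index m + 1 on, the times are smaller than eta; the finitely many
     earlier ones are bounded by a sum *)
  pose m := Num.truncn eta^-1.
  exists (\sum_(k < m.+1) `|T (t k) x| + (`|x| + 1)) => _ [n _ <-].
  have [nm|mn] := ltnP n m.+1.
    rewrite (bigD1 (Ordinal nm))//= -addrA lerDl addr_ge0 ?addr_ge0//.
    exact: sumr_ge0.
  have [t_ge0 t_le _] := tP n.
  apply: le_trans (_ : `|x| + 1 <= _); last by rewrite lerDr sumr_ge0.
  rewrite -lerBlDl; apply: le_trans (lerB_dist _ _) _.
  apply/ltW/etaP => //; apply: le_lt_trans t_le _.
  rewrite -[ltRHS]invrK ltf_pV2 ?posrE ?invr_gt0//.
  apply: lt_le_trans (truncnS_gt _) _.
  by rewrite ler_nat ltnW.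
have [t_ge0 _ [x]] := tP (Num.truncn M).+1.
have [f fE] := semigroup_linear t_ge0.
have [->|x0] := eqVneq x 0; first by rewrite fE linear0 normr0 mulr0 ltxx.
have nx_gt0 : 0 < `|x| by rewrite normr_gt0.
apply/negP; rewrite -leNgt.
have /(_ (`|x|^-1 *: x)) := MP _ (imageP _ (I : setT (Num.truncn M).+1)).
rewrite fE linearZ/= !normrZ normfV normr_id mulVf ?gt_eqF// => /(_ (lexx _)).
rewrite mulrC ler_pdivrMr// => /le_trans; apply.
by rewrite ler_wpM2r// ltW// truncnS_gt.
Qed.

Lemma semigroup_bound tau :
  exists2 M, 1 <= M & forall t x, 0 <= t -> t <= tau -> `|T t x| <= M * `|x|.
Proof.
have [h h_gt0 [M0 M0P]] := semigroup_bound_near0.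
pose M := Num.max M0 1.
have MP t x : 0 <= t -> t <= h -> `|T t x| <= M * `|x|.
  move=> t0 th; apply: le_trans (M0P _ _ t0 th) _.
  by rewrite ler_wpM2r// le_max lexx.
have M_ge1 : 1 <= M by rewrite le_max lexx orbT.
have step k : exists2 M, 1 <= M &
    forall t x, 0 <= t -> t <= k%:R * h -> `|T t x| <= M * `|x|.
  elim: k => [|k [M' M'1 M'P]].
    exists 1 => // t x t_ge0; rewrite mul0r => t_le0.
    by rewrite (_ : t = 0) ?(C0_id T_semigroup) ?mul1r//; apply/le_anti/andP.
  exists (M * M') => [|t x t_ge0 t_le]; first exact: mulr_ege1.
  have [th|ht] := leP t h.
    apply: le_trans (MP _ _ t_ge0 th) _.
    by rewrite ler_wpM2r// ler_peMr// (le_trans ler01).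
  rewrite -(subrKC h t) (C0_add T_semigroup) ?subr_ge0 ?(ltW ht) ?(ltW h_gt0)//.
  apply: le_trans (MP _ _ (ltW h_gt0) (lexx _)) _.
  rewrite -mulrA ler_wpM2l ?(le_trans ler01)// M'P ?subr_ge0 ?(ltW ht)//.
  by rewrite lerBlDr -[X in _ + X]mul1r -mulrDl natr1.
have [M' M'1 M'P] := step (Num.truncn (tau / h)).+1.
exists M' => // t x t_ge0 t_le; apply: M'P => //.
rewrite -ler_pdivrMr//; apply: le_trans (ltW (truncnS_gt _)).
by rewrite ler_pM2r ?invr_gt0.
Qed.

(** The truncation at 0 makes the orbit a function on the whole line without
    changing it at nonnegative times. Strong continuity at 0 only gives
    continuity from the right; the local bound gives it from the left. *)
Lemma orbit_continuous x : continuous (fun t : R => T (Num.max t 0) x).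
Proof.
move=> t; apply/cvgrPdist_lt => e e_gt0.
have [M M_ge1 MP] := semigroup_bound (Num.max t 0 + 1).
have M_gt0 : 0 < M by exact: lt_le_trans M_ge1.
have [eta eta_gt0 etaP] := semigroup_near0 x (divr_gt0 e_gt0 M_gt0).
have close a b : 0 <= a -> a <= b -> b - a < eta -> a <= Num.max t 0 + 1 ->
    `|T b x - T a x| < e.
  move=> a_ge0 ab ba_eta a_le; have ba_ge0 : 0 <= b - a by rewrite subr_ge0.
  rewrite -{1}(subrKC a b) (C0_add T_semigroup)// -semigroupB//.
  apply: le_lt_trans (MP _ _ a_ge0 a_le) _.
  by rewrite mulrC -ltr_pdivlMr// etaP.
have max_lip (u v : R) : `|Num.max u 0 - Num.max v 0| <= `|u - v|.
  by case: (leP u 0); case: (leP v 0); case: (lerP u v) => *;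
    rewrite ?ler_norml; lra.
have near_t d : 0 < d -> \forall s \near t, `|t - s| < d.
  by move=> d_gt0; apply/nbhs_ballP; exists d.
near=> s; have := max_lip t s.
have ts_eta : `|t - s| < eta by near: s; exact: near_t.
have ts_1 : `|t - s| < 1 by near: s; exact: near_t.
have s_ge0 : 0 <= Num.max s 0 by rewrite le_max lexx orbT.
have t_ge0 : 0 <= Num.max t 0 by rewrite le_max lexx orbT.
move: (Num.max s 0) (Num.max t 0) s_ge0 t_ge0 close => s' t' s_ge0 t_ge0 close.
have [st|ts] := leP s' t' => tsd.
  by have := ler_norm (t' - s') => ?; apply: close; lra.
rewrite distrC; rewrite distrC in tsd.
by have := ler_norm (s' - t') => ?; apply: close; lra.
Unshelve. all: by end_near. Qed.

(** The infimum of this set is the growth bound of the semigroup. *)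
Definition growth_exponents : set R :=
  [set w | exists C, forall t x, 0 <= t -> `|T t x| <= C * expR (w * t) * `|x|].

(** One time suffices: any [t] is a multiple of [tau] plus a remainder, at which
    the semigroup is uniformly bounded. *)
Lemma growth_exponent_of_time tau w : 0 < tau ->
  (forall x, `|T tau x| <= expR (w * tau) * `|x|) -> growth_exponents w.
Proof.
move=> tau_gt0 Ttau; have [M M_ge1 MP] := semigroup_bound tau.
have M_ge0 : 0 <= M := le_trans ler01 M_ge1.
have Tn n x : `|iter n (T tau) x| <= expR (w * tau) ^+ n * `|x|.
  elim: n => [|n IH]; first by rewrite expr0 mul1r.
  apply: le_trans (Ttau _) _; rewrite exprS -mulrA.
  by rewrite ler_wpM2l ?expR_ge0.
exists (M * expR (`|w| * tau)) => t x t_ge0.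
have := truncn_itv (divr_ge0 t_ge0 (ltW tau_gt0)).
rewrite ler_pdivlMr// ltr_pdivrMr//.
set n := Num.truncn _ => /andP[nt tn].
set q := t - n%:R * tau.
have q_ge0 : 0 <= q by rewrite subr_ge0.
have q_le : q <= tau.
  by rewrite lerBlDl -[X in _ + X]mul1r -mulrDl natr1 ltW.
have tE : t = n%:R * tau + q by rewrite addrC subrK.
rewrite {1}tE (C0_add T_semigroup) ?mulr_ge0 ?(ltW tau_gt0)//.
rewrite semigroup_iter ?(ltW tau_gt0)//; apply: le_trans (Tn _ _) _.
apply: le_trans (ler_wpM2l _ (MP _ _ q_ge0 q_le)) _.
  by rewrite exprn_ge0// expR_ge0.
rewrite mulrCA mulrA ler_wpM2r// -mulrA ler_wpM2l// -expRM_natl -expRD ler_expR.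
have q_bound : - (`|w| * q) <= w * q.
  by rewrite -mulNr ler_wpM2r// lerNl -normrN ler_norm.
have q_tau : `|w| * q <= `|w| * tau by rewrite ler_wpM2l.
by rewrite tE mulrDr mulrCA; lra.
Qed.

Lemma growth_exponents_nonempty : growth_exponents !=set0.
Proof.
have [M M_ge1 MP] := semigroup_bound 1.
exists (ln M); apply: (growth_exponent_of_time ltr01) => x.
by rewrite mulr1 lnK ?posrE ?(lt_le_trans ltr01)// MP.
Qed.

End Semigroup.

(** * Eigenvectors of the generator and exponential orbits *)

Section LimsupBound.
Variables (R : realType) (B : completeNormedModType R) (T : R -> B -> B).

Lemma limf_esup_le_growth_exponent w xi : growth_exponents T w ->
  (limf_esup (fun t : R => (t^-1)%:E * lne (`|T t xi|)%:E) (pinfty_nbhs R)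
    <= w%:E)%E.
Proof.
move=> [C CP]; apply/lee_addgt0Pr => e e_gt0.
pose D := Num.max 1 (C * `|xi|).
have D_ge1 : 1 <= D by rewrite le_max lexx.
have D_gt0 : 0 < D by exact: lt_le_trans D_ge1.
pose t0 := Num.max 1 (ln D / e).
apply: le_trans (ereal_inf_lbound _) _.
  exists [set t | t0 < t]; last reflexivity.
  by exists t0; split => //; rewrite num_real.
apply: ge_ereal_sup => _ [t t0t <-].
(* states the goal in reduced form without unfolding lne *)
suff: ((t^-1)%:E * lne (`|T t xi|)%:E <= w%:E + e%:E)%E by [].
have /andP[t_gt1 t_gt] : (1 < t) && (ln D / e < t) by rewrite -gt_max.
have t_gt0 : 0 < t by exact: lt_trans t_gt1.
have [T0|T0] := leP `|T t xi| 0.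
  by rewrite le0_lneNy ?lee_fin// gt0_muleNy ?lte_fin ?invr_gt0// leNye.
rewrite lne_EFin// -EFinM -EFinD lee_fin mulrC ler_pdivrMr//.
apply: (@le_trans _ _ (ln (D * expR (w * t)))).
  rewrite ler_ln ?posrE ?mulr_gt0 ?expR_gt0//.
  apply: le_trans (CP _ _ (ltW t_gt0)) _.
  by rewrite mulrAC ler_wpM2r ?expR_ge0// le_max lexx orbT.
rewrite lnM ?posrE ?expR_gt0// expRK mulrDl addrC lerD2l.
by move: t_gt; rewrite ltr_pdivrMr// mulrC => /ltW.
Qed.

End LimsupBound.

Lemma is_derive_cvg_right (R : realType) (f : R -> R) (d : R) :
  is_derive (0 : R) 1 f d -> (f h - f 0) / h @[h --> 0^'+] --> d.
Proof.
move=> fd; have := @ex_derive _ _ _ _ _ _ _ fd.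
have := @derive_val _ _ _ _ _ _ _ fd; rewrite /derivable /derive => <- fcvg.
apply: cvg_trans (cvg_dnbhs_at_right fcvg).
apply: near_eq_cvg; near=> h.
by rewrite /= addr0 /GRing.scale/= mulr1 mulrC.
Unshelve. all: by end_near. Qed.

Section ComplexExponential.
Variables (R : realType) (l : R[i]).

Definition cexp (t : R) : R[i] :=
  Complex (expR (complex.Re l * t) * cos (complex.Im l * t))
          (expR (complex.Re l * t) * sin (complex.Im l * t)).

Lemma cexp0 : cexp 0 = 1.
Proof. by rewrite /cexp !mulr0 expR0 cos0 sin0 mulr0 mulr1. Qed.

Lemma cexpD s t : cexp (s + t) = cexp s * cexp t.
Proof.
apply/eqP; rewrite eq_complex /= !mulrDr expRD cosD sinD.
by apply/andP; split; apply/eqP; ring.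
Qed.

Lemma normc_cexp t : normc (cexp t) = expR (complex.Re l * t).
Proof.
rewrite /= !exprMn -mulrDr cos2Dsin2 mulr1 sqrtr_sqr ger0_norm//.
Qed.

(** This limit and the next one say that [cexp] has derivative [l] at 0. *)
Lemma cexp_quotient_Re :
  (complex.Re (cexp h) - 1) / h @[h --> 0^'+] --> complex.Re l.
Proof.
have d : is_derive (0 : R) 1 (fun t => complex.Re (cexp t)) (complex.Re l).
  rewrite /=; apply: is_derive_eq.
  by rewrite !mulr0 expR0 cos0 sin0 /GRing.scale/=; ring.
have := is_derive_cvg_right d.
by rewrite cexp0.
Qed.

Lemma cexp_quotient_Im :
  complex.Im (cexp h) / h @[h --> 0^'+] --> complex.Im l.
Proof.
have d : is_derive (0 : R) 1 (fun t => complex.Im (cexp t)) (complex.Im l).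
  rewrite /=; apply: is_derive_eq.
  by rewrite !mulr0 expR0 cos0 sin0 /GRing.scale/=; ring.
have := is_derive_cvg_right d; rewrite cexp0 /=.
by under eq_fun do rewrite subr0.
Qed.

End ComplexExponential.

Definition cmap (R : realType) (B : normedModType R) (f : B -> B)
    (z : complexification B) : complexification B := (f z.1, f z.2).

Section ComplexifiedSemigroup.
Variables (R : realType) (B : completeNormedModType R) (T : R -> B -> B).
Hypothesis T_semigroup : C0_semigroup T.
Implicit Types (z w : complexification B) (l : R[i]).

Local Notation csemigroup t := (cmap (T t)).

Lemma csemigroupZ t l z : 0 <= t -> csemigroup t (l *: z) = l *: csemigroup t z.
Proof.
move=> t_ge0; rewrite /cmap /= (semigroupB T_semigroup)//.
by rewrite (semigroupD T_semigroup)// !(semigroupZ T_semigroup).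
Qed.

Lemma csemigroupB t z w : 0 <= t ->
  csemigroup t (z - w) = csemigroup t z - csemigroup t w.
Proof. by move=> t_ge0; rewrite /cmap !(semigroupB T_semigroup). Qed.

Lemma csemigroupD s t z : 0 <= s -> 0 <= t ->
  csemigroup (s + t) z = csemigroup s (csemigroup t z).
Proof. by move=> s0 t0; rewrite /cmap !(C0_add T_semigroup). Qed.

Lemma csemigroup0 z : csemigroup 0 z = z.
Proof. by case: z => x y; rewrite /cmap !(C0_id T_semigroup). Qed.

Lemma cnorm_cmap (f : B -> B) M z : (forall x, `|f x| <= M * `|x|) ->
  cnorm (cmap f z) <= M * cnorm z.
Proof. by move=> MP; rewrite /cnorm mulrDr; apply: lerD; exact: MP. Qed.

(** The relation [L z = l z] for the complexified generator, including the
    membership of [z] in its domain. *)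
Definition eigenvector l z :=
  (h^-1 *: (T h z.1 - z.1) @[h --> 0^'+] --> (l *: z).1) /\
  (h^-1 *: (T h z.2 - z.2) @[h --> 0^'+] --> (l *: z).2).

(** Since the generator is linear, two distinct vectors with the same image
    differ by an eigenvector. *)
Lemma point_spectrumP l : point_spectrum (generator T) l <->
  exists2 z, z != 0 & eigenvector l z.
Proof.
split=> [ninj|[z z_neq0 [z1 z2]] inj].
  apply: contrapT => noeig; apply: ninj => u v.
  move=> /set_mem[/= u1 u2] /set_mem[/= v1 v2] uv.
  apply/eqP; rewrite -subr_eq0; apply: contrapT => /negP uv_neq0.
  apply: noeig; exists (u - v) => //.
  have uvE : l *: (u - v) = (lim (h^-1 *: (T h u.1 - u.1) @[h --> 0^'+]) -
      lim (h^-1 *: (T h v.1 - v.1) @[h --> 0^'+]),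
      lim (h^-1 *: (T h u.2 - u.2) @[h --> 0^'+]) -
      lim (h^-1 *: (T h v.2 - v.2) @[h --> 0^'+])).
    have -> : l *: (u - v) = op_fun (complexified_operator (generator T)) u -
        op_fun (complexified_operator (generator T)) v; last by [].
      have swap (a b c d : complexification B) : a - c = b - d -> a - b = c - d.
        move=> acbd; rewrite -(subrK c a) acbd addrAC [b - d]addrC addrK.
        exact: addrC.
      by rewrite scalerBr; exact: swap.
  have quotB (x y : B) : cvg (h^-1 *: (T h x - x) @[h --> 0^'+]) ->
      cvg (h^-1 *: (T h y - y) @[h --> 0^'+]) ->
      h^-1 *: (T h (x - y) - (x - y)) @[h --> 0^'+] -->
        lim (h^-1 *: (T h x - x) @[h --> 0^'+]) -
        lim (h^-1 *: (T h y - y) @[h --> 0^'+]).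
    move=> xc yc; apply: cvg_trans (cvgB xc yc).
    apply: near_eq_cvg; near=> h.
    by rewrite (semigroupB T_semigroup)// fctE -scalerBr !opprD addrACA !opprK.
  by split; rewrite uvE; exact: quotB.
have quot0 : h^-1 *: (T h 0 - 0) @[h --> 0^'+] --> (0 : B).
  apply: cvg_near_cst; near=> h.
  rewrite -[X in T h X](subrr (0 : B)) (semigroupB T_semigroup)//.
  by rewrite subrr subr0 scaler0.
move/eqP: z_neq0; apply; apply: inj.
- apply/mem_set; split; first by apply/cvg_ex; exists (l *: z).1.
  by apply/cvg_ex; exists (l *: z).2.
- by apply/mem_set; split; apply/cvg_ex; exists 0.
- rewrite /= (cvg_lim _ z1)// (cvg_lim _ z2)// (cvg_lim _ quot0)// scaler0.
  by rewrite -surjective_pairing subrr subrr.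
Unshelve. all: by end_near. Qed.

Lemma eigenvector_cexp_small l z e : eigenvector l z -> 0 < e ->
  exists2 eta, 0 < eta & forall h, 0 < h -> h < eta ->
    cnorm (csemigroup h z - cexp l h *: z) <= e * h.
Proof.
case: z => x y [/= zx zy] e_gt0.
have e2 : 0 < e / 2 by rewrite divr_gt0.
have re := @cexp_quotient_Re _ l; have im := @cexp_quotient_Im _ l.
have lim1 : h^-1 *: (T h x - x) - (((complex.Re (cexp l h) - 1) / h) *: x -
    (complex.Im (cexp l h) / h) *: y) @[h --> 0^'+] --> (0 : B).
  rewrite -(subrr (complex.Re l *: x - complex.Im l *: y)).
  by apply: cvgB => //; apply: cvgB; exact: cvgZr_tmp.
have lim2 : h^-1 *: (T h y - y) - (((complex.Re (cexp l h) - 1) / h) *: y +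
    (complex.Im (cexp l h) / h) *: x) @[h --> 0^'+] --> (0 : B).
  rewrite -(subrr (complex.Re l *: y + complex.Im l *: x)).
  by apply: cvgB => //; apply: cvgD; exact: cvgZr_tmp.
have [d1 d1_gt0 d1P] := iffLR (near0_rightP _) (cvgr0_norm_lt _ lim1 _ e2).
have [d2 d2_gt0 d2P] := iffLR (near0_rightP _) (cvgr0_norm_lt _ lim2 _ e2).
exists (Num.min d1 d2) => [|h h_gt0]; first by rewrite lt_min d1_gt0.
rewrite lt_min => /andP[/(d1P _ h_gt0) h1 /(d2P _ h_gt0) h2].
have scale (v : B) : `|h^-1 *: v| < e / 2 -> `|v| <= e / 2 * h.
  by rewrite normrZ normfV gtr0_norm// mulrC ltr_pdivrMr// => /ltW.
have -> : e * h = e / 2 * h + e / 2 * h by lra.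
rewrite /cnorm /=; apply: lerD; apply: scale.
- apply: le_lt_trans h1; rewrite le_eqVlt; apply/predU1P; left; congr `|_|.
  rewrite /cexp/=; move: (expR _ * cos _) (expR _ * sin _) => u v.
  rewrite ![_ / h]mulrC -!scalerA -!scalerBr; congr (_ *: _).
  rewrite scalerBl scale1r -!addrA; congr (_ + _); rewrite !opprD !opprK.
  by rewrite (addrCA (- x)) addKr.
- apply: le_lt_trans h2; rewrite le_eqVlt; apply/predU1P; left; congr `|_|.
  rewrite /cexp/=; move: (expR _ * cos _) (expR _ * sin _) => u v.
  rewrite ![_ / h]mulrC -!scalerA -!scalerDr -!scalerBr; congr (_ *: _).
  rewrite scalerBl scale1r -!addrA; congr (_ + _); rewrite !opprD !opprK.
  by rewrite (addrCA (- y)) addKr.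
Qed.

(** lam z = L z *)
(** The curve [w s = exp (- l s) T_s z] moves by [o(h)] on a step of length [h]
    starting at 0, hence by at most a constant times [o(h)] on each of the steps
    from [n h] to [(n + 1) h] inside [[0, t]]; adding [t / h] of them shows
    that it stays at [z]. *)
Lemma eigenvector_orbit l z t : eigenvector l z -> 0 <= t ->
  csemigroup t z = cexp l t *: z.
Proof.
move=> zl; rewrite le_eqVlt => /predU1P[<-|t_gt0].
  by rewrite csemigroup0 cexp0 scale1r.
have [M M_ge1 MP] := semigroup_bound T_semigroup t.
have M_gt0 : 0 < M by exact: lt_le_trans M_ge1.
pose w s := cexp l (- s) *: csemigroup s z.
pose E := expR (`|complex.Re l| * t).
have E_gt0 : 0 < E by exact: expR_gt0.
have cexp_le s : 0 <= s -> s <= t -> normc (cexp l (- s)) <= E.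
  move=> s_ge0 st; rewrite normc_cexp ler_expR mulrN -mulNr.
  apply: le_trans (ler_norm _) _; rewrite normrM normrN (ger0_norm s_ge0).
  by rewrite ler_wpM2l.
have wn h n : 0 <= h -> n%:R * h <= t ->
    cnorm (w (n%:R * h) - z) <= n%:R * (2 * E * M * cnorm (w h - z)).
  move=> h_ge0; elim: n => [|n IH] nh.
    by rewrite !mul0r /w oppr0 cexp0 csemigroup0 scale1r subrr cnorm0.
  have nh' : n%:R * h <= t.
    by apply: le_trans nh; rewrite ler_wpM2r// ler_nat.
  have nh_ge0 : 0 <= n%:R * h by rewrite mulr_ge0.
  have -> : w (n.+1%:R * h) - z =
      cexp l (- (n%:R * h)) *: csemigroup (n%:R * h) (w h - z) +
      (w (n%:R * h) - z).
    rewrite csemigroupB// scalerBr addrA subrK /w csemigroupZ// scalerA.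
    by rewrite -cexpD -csemigroupD// -opprD -natr1 mulrDl mul1r.
  apply: le_trans (ler_cnormD _ _) _.
  rewrite -natr1 mulrDl mul1r addrC lerD ?IH//.
  apply: le_trans (ler_cnormZ _ _) _.
  rewrite -[leRHS]mulrA ler_pM ?mulr_ge0 ?normc_ge0 ?cnorm_ge0//.
    by rewrite ler_pM2l// cexp_le.
  by rewrite cnorm_cmap// => x; exact: MP.
pose K := 2 * E * M * (2 * E) * t.
have K_gt0 : 0 < K by rewrite !mulr_gt0.
have small e : 0 < e -> cnorm (w t - z) <= K * e.
  move=> e_gt0; have [eta eta_gt0 etaP] := eigenvector_cexp_small zl e_gt0.
  pose n := (Num.truncn (t / eta)).+1; pose h := t / n%:R.
  have n_gt0 : 0 < n%:R :> R by rewrite ltr0n.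
  have h_gt0 : 0 < h by rewrite divr_gt0.
  have h_lt : h < eta.
    by rewrite ltr_pdivrMr// mulrC -ltr_pdivrMr// truncnS_gt.
  have nhE : n%:R * h = t by rewrite mulrC divfK// gt_eqF.
  have h_le : h <= t by rewrite -[leRHS]nhE ler_peMl ?(ltW h_gt0)// ler1n.
  have wh : cnorm (w h - z) <= 2 * E * (e * h).
    have -> : w h - z = cexp l (- h) *: (csemigroup h z - cexp l h *: z).
      by rewrite scalerBr scalerA -cexpD addNr cexp0 scale1r.
    apply: le_trans (ler_cnormZ _ _) _.
    rewrite ler_pM ?mulr_ge0 ?normc_ge0 ?cnorm_ge0 ?etaP//.
    by rewrite ler_pM2l// cexp_le// ltW.
  rewrite -[X in w X]nhE; apply: le_trans (wn _ _ (ltW h_gt0) _) _.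
    by rewrite nhE.
  have -> : K * e = n%:R * (2 * E * M * (2 * E * (e * h))).
    by rewrite /K -[X in _ * X * e]nhE; ring.
  by rewrite !ler_pM2l// !mulr_gt0.
have /cnorm_eq0/eqP : cnorm (w t - z) = 0.
  apply/le_anti; rewrite cnorm_ge0 andbT leNgt; apply/negP => c_gt0.
  have := small _ (divr_gt0 c_gt0 (mulr_gt0 (ltr0Sn R 1) K_gt0)).
  clearbody K; have -> : K * (cnorm (w t - z) / (2 * K)) = cnorm (w t - z) / 2.
    by field; rewrite gt_eqF.
  lra.
rewrite subr_eq0 => /eqP wz.
by rewrite -[in RHS]wz /w scalerA -cexpD subrr cexp0 scale1r.
Qed.

(** The orbit of an eigenvector grows exactly like [exp (Re l t)]. *)
Lemma Re_eigenvalue_le_growth_exponent l z (w : R) :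
  eigenvector l z -> z != 0 ->
  growth_exponents T w -> complex.Re l <= w.
Proof.
move=> zl z_neq0 [C CP]; have z_gt0 := cnorm_gt0 z_neq0.
rewrite leNgt -subr_gt0; set d := _ - w; apply/negP => d_gt0.
have bound t : 0 <= t -> expR (d * t) <= 2 * C.
  move=> t_ge0; have := ler_normc_cnorm (cexp l t) z.
  rewrite normc_cexp -eigenvector_orbit// => zle.
  have zle' := cnorm_cmap z (fun x => CP t x t_ge0).
  rewrite mulrBl expRD expRN ler_pdivrMr ?expR_gt0//.
  rewrite -(ler_pM2r z_gt0); apply: le_trans zle _.
  by rewrite -!mulrA ler_pM2l// mulrA.
have C_ge0 : 0 <= C.
  have := bound 0 (lexx _); rewrite mulr0 expR0; lra.
have := bound (2 * C / d) (divr_ge0 (mulr_ge0 (ler0n R 2) C_ge0) (ltW d_gt0)).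
rewrite mulrC divfK ?gt_eqF//; have := expR_ge1Dx (2 * C); lra.
Qed.

End ComplexifiedSemigroup.

(** * Approximate eigenvectors of a compact operator *)

Section UltrafilterLimits.
Variables (R : realType) (B : normedModType R).
Implicit Types (z w : complexification B).

(** Ultrafilter limits replace the successive extraction of subsequences: along
    one ultrafilter, every sequence with values in a compact set converges. *)
Lemma ultra_fmap (S V : Type) (U : set_system S) (f : S -> V) :
  UltraFilter U -> UltraFilter (f @ U).
Proof.
move=> U_ultra; split=> [|G G_proper UG]; first exact: fmap_proper_filter.
rewrite predeqE => A; split=> [GA|]; last exact: UG.
have [//|UnA] := in_ultra_setVsetC (f @^-1` A) U_ultra.
have /UG GnA : (f @ U) (~` A) by [].
by have /filter_ex[x []] : G (A `&` ~` A) by exact: filterI.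
Qed.

Lemma ultra_cvg_of_compact (V : topologicalType) (K : set V)
    (U : set_system nat) (u : nat -> V) :
  UltraFilter U -> compact K -> (forall n, K (u n)) ->
  exists l : V, u @ U --> l.
Proof.
move=> U_ultra; rewrite compact_ultra => Kc Ku.
have [|l [_ ul]] := Kc _ (ultra_fmap u U_ultra); last by exists l.
by apply: (@filterE _ U) => n; exact: Ku.
Qed.

Lemma ultra_cvg_of_bounded (U : set_system nat) (a : nat -> R) b :
  UltraFilter U -> (forall n, `|a n| <= b) -> exists l : R, a @ U --> l.
Proof.
move=> U_ultra ab.
apply: ultra_cvg_of_compact U_ultra (@segment_compact _ (- b) b) _ => n.
by rewrite /= in_itv/= -ler_norml.
Qed.

Definition ccvg (F : set_system nat) (u : nat -> complexification B) z :=
  ((u n).1 @[n --> F] --> z.1) /\ ((u n).2 @[n --> F] --> z.2).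

Section Limits.
Implicit Types u v : nat -> complexification B.
Context {F : set_system nat} {F_proper : ProperFilter F}.

Lemma ccvg_unique u z w : ccvg F u z -> ccvg F u w -> z = w.
Proof.
case: z w => [x y] [x' y'] [/= zx zy] [/= zx' zy'].
by congr pair; [apply: cvg_unique zx zx'|apply: cvg_unique zy zy'];
  exact: norm_hausdorff.
Qed.

Lemma ccvgZ (l_ : nat -> R[i]) (l : R[i]) u z :
  complex.Re (l_ n) @[n --> F] --> complex.Re l ->
  complex.Im (l_ n) @[n --> F] --> complex.Im l ->
  ccvg F u z -> ccvg F (fun n => l_ n *: u n) (l *: z).
Proof.
move=> re im [z1 z2]; split; first by apply: cvgB; exact: cvgZ.
by apply: cvgD; exact: cvgZ.
Qed.

Lemma ccvgD u v z w : ccvg F u z -> ccvg F v w ->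
  ccvg F (fun n => u n + v n) (z + w).
Proof. by move=> [z1 z2] [w1 w2]; split; exact: cvgD. Qed.

Lemma ccvg_cnorm u z : ccvg F u z -> cnorm (u n) @[n --> F] --> cnorm z.
Proof. by move=> [z1 z2]; apply: cvgD; exact: cvg_norm. Qed.

Lemma cvg0_of_cnorm u : cnorm (u n) @[n --> F] --> (0 : R) -> ccvg F u 0.
Proof.
move=> z0; split; apply: norm_cvg0;
  apply: (squeeze_cvgr _ (cvg_cst 0) z0); near=> n;
  by rewrite normr_ge0 /cnorm ?lerDl ?lerDr normr_ge0.
Unshelve. all: by end_near. Qed.

End Limits.

Lemma normc_le_of_cvg (F : set_system nat) (FF : ProperFilter F)
    (l_ : nat -> R[i]) (l : R[i]) b :
  complex.Re (l_ n) @[n --> F] --> complex.Re l ->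
  complex.Im (l_ n) @[n --> F] --> complex.Im l ->
  (forall n, normc (l_ n) <= b) -> normc l <= b.
Proof.
move=> re im lb.
have b_ge0 : 0 <= b by apply: le_trans (lb 0); exact: normc_ge0.
have normcE (k : R[i]) : (normc k <= b) =
    (complex.Re k * complex.Re k + complex.Im k * complex.Im k <= b ^+ 2).
  case: k => x y; rewrite -!expr2 /= -{1}(ger0_norm b_ge0) -sqrtr_sqr.
  by rewrite ler_sqrt// exprn_ge0.
rewrite normcE.
have lim : complex.Re (l_ n) * complex.Re (l_ n) +
    complex.Im (l_ n) * complex.Im (l_ n) @[n --> F] -->
    complex.Re l * complex.Re l + complex.Im l * complex.Im l.
  by apply: cvgD; exact: cvgM.
rewrite -(cvg_lim _ lim)//; apply: limr_le.
  by apply/cvg_ex; eexists; exact: lim.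
by near=> n; rewrite -normcE.
Unshelve. all: by end_near. Qed.

(** Along an ultrafilter the images [K u_n] and the scalars [l_n] converge, so
    [u_n], which is asymptotically [l_n K u_n], converges as well; its limit is
    a genuine eigenvector, normalised like the [u_n]. Writing the eigenvector
    equation as [z = l K z], rather than with the inverse of [l], needs no lower
    bound on the scalars. *)
Lemma compact_approximate_eigenvector (K : B -> B) (l_ : nat -> R[i])
    (u : nat -> complexification B) b :
  compact_operator K -> continuous K ->
  (forall n, normc (l_ n) <= b) -> (forall n, cnorm (u n) = 1) ->
  cnorm (u n - l_ n *: cmap K (u n)) @[n --> \oo] --> (0 : R) ->
  exists U l z, [/\ UltraFilter U, \oo `<=` U, normc l <= b, cnorm z = 1 &
    ccvg U u z /\ z = l *: cmap K z].
Proof.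
move=> [_ K_compact] K_cont lb z1 approx.
have [U [U_ultra ooU]] :=
  ultraFilterLemma (eventually_filter : ProperFilter \oo).
have ball_bounded : bounded_set [set x : B | `|x| <= 1].
  by exists 1; split => // M M_gt1 x /= x1; apply: le_trans x1 (ltW _).
have Kc : compact (closure (K @` [set x : B | `|x| <= 1])).
  by have := K_compact _ ball_bounded; rewrite precompactE.
have [p pP] : exists p : B, K (u n).1 @[n --> U] --> p.
  apply: (ultra_cvg_of_compact U_ultra Kc) => n; apply: subset_closure.
  by exists (u n).1 => //=; rewrite -(z1 n) lerDl.
have [q qP] : exists q : B, K (u n).2 @[n --> U] --> q.
  apply: (ultra_cvg_of_compact U_ultra Kc) => n; apply: subset_closure.
  by exists (u n).2 => //=; rewrite -(z1 n) lerDr.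
have [a aP] := ultra_cvg_of_bounded U_ultra
  (fun n => le_trans (normr_Re_le (l_ n)) (lb n)).
have [c cP] := ultra_cvg_of_bounded U_ultra
  (fun n => le_trans (normr_Im_le (l_ n)) (lb n)).
pose l := Complex a c; pose pq : complexification B := (p, q).
have Kz : ccvg U (fun n => cmap K (u n)) pq by split.
have lKz : ccvg U (fun n => l_ n *: cmap K (u n)) (l *: pq) by exact: ccvgZ.
have zw : ccvg U u (l *: pq).
  have diff0 : ccvg U (fun n => u n - l_ n *: cmap K (u n)) 0.
    by apply: cvg0_of_cnorm; apply: cvg_trans approx => A /ooU.
  have := ccvgD diff0 lKz; rewrite add0r.
  suff -> : (fun n => u n - l_ n *: cmap K (u n) + l_ n *: cmap K (u n)) = u.
    by apply.
  by apply/funext => n; rewrite subrK.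
exists U, l, (l *: pq); split; [by []|by []| | |].
- exact: (@normc_le_of_cvg U _ l_ l b aP cP lb).
- apply: (cvg_unique (@norm_hausdorff _ _) (ccvg_cnorm zw)).
  by apply: cvg_near_cst; apply: nearW => n; exact: z1.
split => //; congr (_ *: _); apply: ccvg_unique Kz _.
by case: zw => zw1 zw2; split; [apply: cvg_comp zw1 _|apply: cvg_comp zw2 _];
  exact: K_cont.
Qed.

End UltrafilterLimits.

(** * An eigenvector on the spectral circle *)

Lemma linear_times_exp_small (R : realType) (C eta : R) n : 0 < eta ->
  exists2 N, (n < N)%N & N%:R * (C * expR (- eta * N%:R)) <= 1.
Proof.
move=> eta_gt0.
pose N := (n + Num.truncn (4 * `|C| / eta ^+ 2)).+1.
exists N; first by rewrite ltnS leq_addr.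
have N_gt0 : 0 < N%:R :> R by rewrite ltr0n.
have NC : 4 * `|C| / eta ^+ 2 <= N%:R.
  apply: le_trans (ltW (truncnS_gt _)) _.
  by rewrite ler_nat ltnS leq_addl.
have u_gt0 : 0 < eta * N%:R by rewrite mulr_gt0.
(* Comparing the exponential with a square rather than with a line absorbs the
   factor N. *)
have sq : (eta * N%:R) ^+ 2 <= 4 * expR (eta * N%:R).
  have := expR_ge1Dx (eta * N%:R / 2).
  have -> : expR (eta * N%:R) = expR (eta * N%:R / 2) ^+ 2.
    by rewrite -expRM_natl; congr expR; lra.
  nra.
have NC' : N%:R * `|C| <= expR (eta * N%:R).
  move: NC; rewrite ler_pdivrMr ?exprn_gt0// => /(ler_wpM2r (ltW N_gt0)).
  by move: sq; rewrite exprMn; lra.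
rewrite mulNr expRN mulrA ler_pdivrMr ?expR_gt0// mul1r.
by apply: le_trans NC'; rewrite ler_wpM2l// ler_norm.
Qed.

Lemma csemigroup_linear (R : realType) (B : completeNormedModType R)
  (T : R -> B -> B) (T_semigroup : C0_semigroup T) t :
  0 <= t -> exists K : {linear complexification B -> complexification B},
    forall z, K z = cmap (T t) z.
Proof.
move=> t_ge0.
have lin : linear (cmap (T t) : complexification B -> complexification B).
  move=> a u v; rewrite -(csemigroupZ T_semigroup)//.
  by rewrite /cmap /= !(semigroupD T_semigroup).
pose K : {linear complexification B -> complexification B} :=
  HB.pack (cmap (T t)) (GRing.isLinear.Build _ _ _ _ _ lin).
by exists K.
Qed.

Section PeripheralEigenvector.
Variables (R : realType) (B : completeNormedModType R) (T : R -> B -> B).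
Hypothesis T_semigroup : C0_semigroup T.
Variable t0 : R.
Hypothesis t0_gt0 : 0 < t0.
Implicit Types z : complexification B.

Let omega := inf (growth_exponents T).

Hypothesis growth_lbound : has_lbound (growth_exponents T).

(** If it fails, the resolvents of the rescaled operators [exp (- w t0) T_t0]
    are bounded on the unit circle, uniformly in [w > omega]. The averaging
    estimate then makes [exp (- w t0 n) T_(n t0)] as small as [1 / 4] for some
    [n], with a choice of [n] that does not depend on [w]. Taking [w] so close to
    [omega] that [exp (w t0 n) = 2 exp (omega t0 n)] yields a growth exponent
    below [omega]. *)
Lemma approximate_peripheral_eigenvector (delta : R) : 0 < delta ->
  exists w x z, [/\ omega < w, normc x = 1 &
    cnorm (z - (x * (expR (- (w * t0)))%:C%C) *: cmap (T t0) z) <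
    delta * cnorm z].
Proof.
move=> delta_gt0; apply: contrapT => nex.
pose C0 := 2 * (2 / delta ^+ 2 + 1 / delta).
have C0_gt0 : 0 < C0.
  by rewrite mulr_gt0// addr_gt0// divr_gt0// exprn_gt0.
pose n := (Num.truncn (4 * C0)).+1.
have n_gt0 : 0 < n%:R :> R by rewrite ltr0n.
pose e := ln 2 / (n%:R * t0).
have nt0 : 0 < n%:R * t0 by rewrite mulr_gt0.
have e_gt0 : 0 < e by rewrite divr_gt0// ln_gt0// ltr1n.
pose w := omega + e.
have [w' [C1 w'P] w'w] : exists2 w', growth_exponents T w' & w' < w.
  apply: inf_adherent e_gt0 _; split => //.
  exact: growth_exponents_nonempty.
have [K KE] := csemigroup_linear T_semigroup (ltW t0_gt0).
pose A := ((expR (- (w * t0)))%:C%C : R[i]) \*: K.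
have iterA m z : iter m A z =
    ((expR (- (w * t0) * m%:R))%:C%C : R[i]) *: cmap (T (m%:R * t0)) z.
  rewrite /A iter_scale_fun -rmorphXn -expRM_natl mulrC; congr (_ *: _).
  rewrite /cmap !(semigroup_iter T_semigroup) ?(ltW t0_gt0)//.
  elim: m => [|m IH]; first by case: z.
  by rewrite !iterS IH KE.
have below x z : normc x = 1 -> delta * cnorm z <= cnorm (z - x *: A z).
  move=> x1; rewrite leNgt; apply/negP => lt.
  apply: nex; exists w, x, z; split=> //; first by rewrite ltrDl.
  by rewrite -KE -scalerA.
have eta_gt0 : 0 < (w - w') * t0 by rewrite mulr_gt0// subr_gt0.
have [N nN NP] := linear_times_exp_small C1 n eta_gt0.
have NA z : N%:R * cnorm (iter N A z) <= cnorm z.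
  rewrite iterA cnormZr ger0_norm ?expR_ge0//.
  have Nt0_ge0 := mulr_ge0 (ler0n R N) (ltW t0_gt0).
  have := cnorm_cmap z (fun x => w'P (N%:R * t0) x Nt0_ge0).
  have E_gt0 := expR_gt0 (- (w * t0) * N%:R).
  move=> /(ler_wpM2l (ltW E_gt0)) /(ler_wpM2l (ler0n R N)) /le_trans; apply.
  rewrite -[leRHS]mul1r !mulrA ler_wpM2r ?cnorm_ge0//; apply: le_trans NP.
  have -> : expR (- ((w - w') * t0) * N%:R) =
      expR (- (w * t0) * N%:R) * expR (w' * (N%:R * t0)).
    by rewrite -expRD; congr expR; ring.
  rewrite le_eqVlt; apply/predU1P; left; rewrite (mulrA w').
  by ring.
have main := orbit_bound_of_bounded_below delta_gt0 below nN NA.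
have : growth_exponents T (omega - e).
  apply: (growth_exponent_of_time T_semigroup nt0) => x.
  have := main ((x, 0) : complexification B).
  rewrite iterA cnormZr ger0_norm ?expR_ge0// /cnorm /= normr0 addr0.
  have T0_ge0 : 0 <= `|T (n%:R * t0) 0| by [].
  pose E := expR (w * (n%:R * t0)).
  have E_gt0 : 0 < E by exact: expR_gt0.
  have -> : expR (- (w * t0) * n%:R) = E^-1.
    by rewrite -expRN; congr expR; ring.
  (* the exponent w - 2 e: one factor 1/2 compensates for e in w, the other
     one goes below omega *)
  have -> : expR ((omega - e) * (n%:R * t0)) = E / 4.
    have -> : (omega - e) * (n%:R * t0) = w * (n%:R * t0) - ln 2 - ln 2.
      by rewrite /w /e; field; rewrite !gt_eqF.
    by rewrite !expRD !expRN lnK ?posrE// -/E; field.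
  have n4 : 4 * C0 <= n.+1%:R.
    by apply: le_trans (ltW (truncnS_gt _)) _; rewrite ler_nat.
  rewrite -/C0 mulrA mulrC -ler_pdivlMr ?mulr_gt0 ?invr_gt0// => Tx.
  apply: le_trans (_ : _ <= `|T (n%:R * t0) x| + `|T (n%:R * t0) 0|) _.
    by rewrite lerDl.
  apply: le_trans Tx _; rewrite invf_div mulrAC ler_wpM2r//.
  by rewrite mulrCA ler_pM2l// ler_pdivrMr//; lra.
move=> /(inf_lbound growth_lbound).
by rewrite leNgt => /negP; apply; rewrite ltrBlDr ltrDl.
Qed.

(** Approximate eigenvectors, for scalars whose modulus is at least the spectral
    radius [exp (omega t0)], accumulate at an eigenvector because [T_t0] is
    compact. *)
Lemma peripheral_eigenvector : compact_operator (T t0) ->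
  exists l z, [/\ normc l <= expR (- (omega * t0)), cnorm z = 1 &
    z = l *: cmap (T t0) z].
Proof.
move=> T_compact.
have ex n : exists p : R[i] * complexification B,
    [/\ normc p.1 <= expR (- (omega * t0)), cnorm p.2 = 1 &
      cnorm (p.2 - p.1 *: cmap (T t0) p.2) <= n.+1%:R^-1].
  have [|w [x [z [w_gt x1 zP]]]] :=
    @approximate_peripheral_eigenvector n.+1%:R^-1.
    by rewrite invr_gt0.
  have z_gt0 : 0 < cnorm z.
    rewrite -(pmulr_rgt0 _ (_ : 0 < n.+1%:R^-1)) ?invr_gt0//.
    by rewrite (le_lt_trans _ zP)// cnorm_ge0.
  pose a := (((cnorm z)^-1)%:C)%C : R[i].
  exists (x * (expR (- (w * t0)))%:C%C, a *: z); split => /=.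
  - rewrite normcM x1 mul1r normc_real ger0_norm ?expR_ge0// ler_expR lerN2.
    by rewrite ler_pM2r// ltW.
  - by rewrite cnormZr ger0_norm ?invr_ge0 ?cnorm_ge0// mulVf// gt_eqF.
  - rewrite (csemigroupZ T_semigroup _ _ (ltW t0_gt0)) scalerA [_ * a]mulrC.
    rewrite -scalerA -scalerBr cnormZr ger0_norm ?invr_ge0 ?cnorm_ge0//.
    by rewrite ler_pdivrMl// [leRHS]mulrC ltW.
have [p pP] := choice ex.
have [||||U [l [z [_ _ lb z1 [_ zE]]]]] :=
  @compact_approximate_eigenvector _ _ (T t0) (fun n => (p n).1)
    (fun n => (p n).2) (expR (- (omega * t0))) T_compact.
- exact: (C0_continuous T_semigroup (ltW t0_gt0)).
- by move=> n; have [] := pP n.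
- by move=> n; have [] := pP n.
- apply: (squeeze_cvgr _ (cvg_cst 0) (@cvg_harmonic R)); near=> n.
  by rewrite cnorm_ge0; have [] := pP n.
by exists l, z.
Unshelve. all: by end_near. Qed.

End PeripheralEigenvector.

(** * From one operator to the whole semigroup *)

Section CommonEigenvector.
Variables (R : realType) (B : completeNormedModType R) (T : R -> B -> B).
Hypothesis T_semigroup : C0_semigroup T.
Variable t0 : R.
Hypothesis t0_gt0 : 0 < t0.
Implicit Types z w y : complexification B.

Local Notation csemigroup t := (cmap (T t)).
Let step m : R := t0 / 2 ^+ m.

Let step_gt0 m : 0 < step m.
Proof. by rewrite divr_gt0// exprn_gt0. Qed.

Lemma csemigroup_natmul_eigen t n c z : 0 <= t -> csemigroup t z = c *: z ->
  csemigroup (n%:R * t) z = c ^+ n *: z.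
Proof.
move=> t_ge0 tz; elim: n => [|n IH].
  by rewrite mul0r (csemigroup0 T_semigroup) expr0 scale1r.
rewrite -natr1 mulrDl mul1r addrC (csemigroupD T_semigroup) ?mulr_ge0// IH.
by rewrite (csemigroupZ T_semigroup)// tz scalerA exprSr.
Qed.

(** Halving the time step takes a square root: with [S] the operator of the half
    step and [nu ^ 2 = c], either [S y = nu y], or [S y - nu y] is a nonzero
    eigenvector of [S] for [- nu], since [S ^ 2 - nu ^ 2] kills [y]. In both
    cases the new vector remains an eigenvector of [T_t0], which commutes with
    [S]. *)
Lemma dyadic_eigenvector l z m : z != 0 -> z = l *: csemigroup t0 z ->
  exists y c, [/\ y != 0, y = l *: csemigroup t0 y &
    csemigroup (step m) y = c *: y].
Proof.
move=> z_neq0 zl; have t0_ge0 := ltW t0_gt0.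
elim: m => [|m [y [c [y_neq0 yl yc]]]].
  have l_neq0 : l != 0.
    by apply: contra_neq z_neq0 => l0; rewrite zl l0 scale0r.
  exists z, l^-1; split => //.
  by rewrite /step expr0 divr1 [in RHS]zl scalerA mulVf// scale1r.
have s_ge0 := ltW (step_gt0 m.+1).
pose S := csemigroup (step m.+1); pose nu := sqrtC c.
have SS : S (S y) = c *: y.
  rewrite /S -(csemigroupD T_semigroup)// -yc; congr (cmap (T _) y).
  by rewrite /step exprS; field; rewrite expf_neq0.
have [Sy|Sy] := eqVneq (S y) (nu *: y); first by exists y, nu.
exists (S y - nu *: y), (- nu); split; first by rewrite subr_eq0.
  have comm : csemigroup t0 (S y) = S (csemigroup t0 y).
    by rewrite /S -!(csemigroupD T_semigroup)// addrC.
  have Sl : l *: S (csemigroup t0 y) = S y.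
    by rewrite -(csemigroupZ T_semigroup)// -yl.
  rewrite (csemigroupB T_semigroup)// (csemigroupZ T_semigroup)// comm.
  by rewrite scalerBr Sl scalerA mulrC -scalerA -yl.
rewrite (csemigroupB T_semigroup)// (csemigroupZ T_semigroup)// -/S SS.
by rewrite scalerBr !scaleNr opprK scalerA -expr2 sqrtCK addrC.
Qed.

(** The normalised eigenvectors of the operators of the steps [t0 / 2 ^ m] lie
    in one eigenspace of the compact operator [T_t0], so they accumulate at
    some [w]. Any time is approximated by multiples of these steps, whose
    operators act on the [m]-th vector as scalars; these scalars are bounded, so
    they converge too, and every operator acts on [w] as a scalar. *)
Lemma common_eigenvector l z : compact_operator (T t0) ->
  z != 0 -> z = l *: csemigroup t0 z ->
  exists l' w, [/\ normc l' <= normc l, cnorm w = 1, w = l' *: csemigroup t0 w &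
    forall t, 0 <= t -> exists c, csemigroup t w = c *: w].
Proof.
move=> T_compact z_neq0 zl.
have ex m : exists p : complexification B * R[i], [/\ cnorm p.1 = 1,
    p.1 = l *: csemigroup t0 p.1 & csemigroup (step m) p.1 = p.2 *: p.1].
  have [y [c [y_neq0 yl yc]]] := dyadic_eigenvector m z_neq0 zl.
  have y_gt0 := cnorm_gt0 y_neq0.
  pose a := (((cnorm y)^-1)%:C)%C : R[i].
  exists (a *: y, c); split => /=.
  - by rewrite cnormZr ger0_norm ?invr_ge0 ?cnorm_ge0// mulVf// gt_eqF.
  - rewrite (csemigroupZ T_semigroup) ?(ltW t0_gt0)// scalerA mulrC -scalerA.
    by rewrite -yl.
  - rewrite (csemigroupZ T_semigroup) ?(ltW (step_gt0 m))// yc.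
    by rewrite !scalerA mulrC.
have [p pP] := choice ex.
pose y m := (p m).1; pose c m := (p m).2.
have [||||U [l' [w [U_ultra ooU l'l w1 [yw wl]]]]] :=
  @compact_approximate_eigenvector _ _ (T t0) (fun=> l) y (normc l) T_compact.
- exact: (C0_continuous T_semigroup (ltW t0_gt0)).
- by [].
- by move=> m; have [] := pP m.
- apply: cvg_near_cst; apply: nearW => m; have [_ yl _] := pP m.
  by rewrite /y -yl subrr cnorm0.
exists l', w; split => // t t_ge0.
pose n m := Num.truncn (t / step m); pose s m := (n m)%:R * step m.
have s_ge0 m : 0 <= s m by rewrite mulr_ge0// ltW.
have nP m : s m <= t /\ t - s m <= step m.
  have := truncn_itv (divr_ge0 t_ge0 (ltW (step_gt0 m))).
  rewrite ler_pdivlMr// ltr_pdivrMr// -natr1 mulrDl mul1r -/(s m).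
  by move=> /andP[? ?]; split => //; lra.
have st : s m @[m --> U] --> t.
  apply: (@cvg_trans _ (s m @[m --> \oo])); first by move=> A /ooU.
  apply/cvgrPdist_le => e e_gt0.
  near=> m; have [sm tsm] := nP m.
  rewrite ger0_norm ?subr_ge0//; apply: le_trans tsm _.
  rewrite /step ler_pdivrMr ?exprn_gt0// -ler_pdivrMl// mulrC.
  apply: le_trans (_ : m%:R <= _).
    by near: m; exact: nbhs_infty_ger.
  by rewrite -natrX ler_nat ltnW// ltn_expl.
have [M M_ge1 MP] := semigroup_bound T_semigroup t.
have yc m : csemigroup (s m) (y m) = c m ^+ n m *: y m.
  by have [_ _ yc] := pP m; apply: csemigroup_natmul_eigen => //; exact: ltW.
have y1 m : cnorm (y m) = 1 by have [] := pP m.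
have MS m z' : cnorm (csemigroup (s m) z') <= M * cnorm z'.
  by apply: cnorm_cmap => x; apply: MP => //; have [] := nP m.
have d_le m : normc (c m ^+ n m) <= 2 * M.
  have := ler_normc_cnorm (c m ^+ n m) (y m); rewrite -yc y1 mulr1.
  move=> /le_trans; apply; rewrite ler_pM2l//.
  by apply: le_trans (MS _ _) _; rewrite y1 mulr1.
have [a aP] := ultra_cvg_of_bounded U_ultra
  (fun m => le_trans (normr_Re_le (c m ^+ n m)) (d_le m)).
have [b bP] := ultra_cvg_of_bounded U_ultra
  (fun m => le_trans (normr_Im_le (c m ^+ n m)) (d_le m)).
exists (Complex a b).
have lim1 : ccvg U (fun m => csemigroup (s m) (y m)) (Complex a b *: w).
  have -> : (fun m => csemigroup (s m) (y m)) = (fun m => c m ^+ n m *: y m).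
    by apply/funext => m; exact: yc.
  exact: ccvgZ.
apply: ccvg_unique lim1.
have orb x : T (s m) x @[m --> U] --> T t x.
  have lim := cvg_comp _ _ st (@orbit_continuous _ _ _ T_semigroup x t).
  rewrite (max_l t_ge0) in lim; apply: cvg_trans lim.
  by apply: near_eq_cvg; apply: nearW => m /=; rewrite max_l.
have lim2 : ccvg U (fun m => csemigroup (s m) (y m - w)) 0.
  apply: cvg0_of_cnorm.
  have yw0 : cnorm (y m - w) @[m --> U] --> (0 : R).
    rewrite -(@cnorm0 R B) -(subrr w).
    apply: ccvg_cnorm; case: yw => yw1 yw2.
    by split; apply: cvgB => //; exact: cvg_cst.
  have Myw0 : M * cnorm (y m - w) @[m --> U] --> (0 : R).
    by rewrite -(mulr0 M); apply: cvgM => //; exact: cvg_cst.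
  apply: (squeeze_cvgr _ (cvg_cst 0) Myw0).
  by near=> m; rewrite cnorm_ge0 MS.
have lim3 : ccvg U (fun m => csemigroup (s m) w) (csemigroup t w).
  by split; exact: orb.
have := ccvgD lim2 lim3; rewrite add0r.
suff -> : (fun m => csemigroup (s m) (y m - w) + csemigroup (s m) w) =
  (fun m => csemigroup (s m) (y m)) by apply.
by apply/funext => m; rewrite (csemigroupB T_semigroup)// subrK.
Unshelve. all: by end_near. Qed.

End CommonEigenvector.

(** * Continuous characters of the half-line *)

(** On a bounded interval only, which is all that the local argument below
    requires. *)
Lemma antiderivative (R : realType) (f : R -> R) (a b : R) : continuous f ->
  exists F : R -> R, forall x, a < x -> x < b -> is_derive x 1 F (f x).
Proof.
move=> f_cont.
exists (fun x => (\int[lebesgue_measure]_(t in `[a, x]) f t)%R) => x ax xb.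
have [|//||der val] := @continuous_FTC1 R f (BLeft a) x b xb.
- apply: continuous_compact_integrable; first exact: segment_compact.
  exact: continuous_subspaceT.
- exact: f_cont.
apply: DeriveDef => //.
by rewrite -derive1E.
Qed.

Lemma increment_MVT (R : realType) (f df : R -> R) (a b : R) : a <= b ->
  (forall x, a <= x -> x <= b -> is_derive x 1 f (df x)) ->
  exists2 x, a <= x <= b & f b - f a = df x * (b - a).
Proof.
move=> ab fdf; have [x|x|x] := @MVT_segment R f df a b ab.
- by rewrite in_itv/= => /andP[ax xb]; apply: fdf; exact: ltW.
- apply: derivable_within_continuous => y; rewrite in_itv/= => /andP[ay yb].
  by have := fdf y ay yb; case.
by rewrite in_itv/= => axb fE; exists x.
Qed.

(** A continuous complex function [c = u + i v] with [c (s + t) = c s c t] is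
    differentiable: with a primitive [C = U + i V], integrating the functional
    equation over [[0, d]] gives [C (t + d) - C t = c t (C d - C 0)]. The left
    side is differentiable in [t], and [C d - C 0] is not 0 for small [d],
    because its real part is the integral of [u], which is positive near 0. *)
Lemma complex_character_right_derivable (R : realType) (u v : R -> R) :
  continuous u -> continuous v -> u 0 = 1 -> v 0 = 0 ->
  (forall s t, 0 <= s -> 0 <= t -> u (s + t) = u s * u t - v s * v t) ->
  (forall s t, 0 <= s -> 0 <= t -> v (s + t) = v s * u t + u s * v t) ->
  exists a b : R, ((u h - 1) / h @[h --> 0^'+] --> a) /\
              (v h / h @[h --> 0^'+] --> b).
Proof.
move=> u_cont v_cont u0 v0 uD vD.
have [U UP] := antiderivative (-1) 3 u_cont.
have [V VP] := antiderivative (-1) 3 v_cont.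
have [d d_gt0 [d_le1 ud]] : exists2 d, 0 < d & d <= 1 /\
    forall s, 0 <= s -> s <= d -> 0 < u s.
  have : \forall s \near (0 : R), 0 < u s.
    by apply: (cvgr_gt (u 0) (u_cont 0)); rewrite u0.
  move=> /nbhs_ballP[e /= e_gt0 eP]; exists (Num.min 1 (e / 2)).
    by rewrite lt_min ltr01 divr_gt0.
  rewrite ge_min lexx; split=> // s s_ge0; rewrite le_min => /andP[_ s_le].
  apply: eP; rewrite /ball/= sub0r normrN ger0_norm//.
  by apply: le_lt_trans s_le _; lra.
have d_ge0 := ltW d_gt0.
have Ushift t s : 0 <= t -> t <= 1 -> 0 <= s -> s <= d ->
    is_derive s 1 (fun s => U (t + s)) (u (t + s)).
  move=> t0 t1 s0 sd; rewrite -[X in is_derive _ _ _ X]mulr1.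
  apply: (@is_derive1_comp _ U (fun s => t + s)); first by apply: UP; lra.
  by rewrite -[X in is_derive _ _ _ X]add0r; apply: is_deriveD.
have Vshift t s : 0 <= t -> t <= 1 -> 0 <= s -> s <= d ->
    is_derive s 1 (fun s => V (t + s)) (v (t + s)).
  move=> t0 t1 s0 sd; rewrite -[X in is_derive _ _ _ X]mulr1.
  apply: (@is_derive1_comp _ V (fun s => t + s)); first by apply: VP; lra.
  by rewrite -[X in is_derive _ _ _ X]add0r; apply: is_deriveD.
pose p := U d - U 0; pose q := V d - V 0.
have p_gt0 : 0 < p.
  have [x /andP[x0 xd] pE] : exists2 x, 0 <= x <= d & U d - U 0 = u x * (d - 0).
    by apply: increment_MVT => // x x0 xd; apply: UP; lra.
  by rewrite /p pE subr0 mulr_gt0// ud.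
(* These two equations are the real and imaginary parts of
   C (d + t) - C t = c t (C d - C 0). *)
have UE t : 0 <= t -> t <= 1 -> U (d + t) - U t = u t * p - v t * q.
  move=> t0 t1.
  have [s s0 sd|x /andP[x0 xd]] := @increment_MVT R
    ((fun s => U (t + s)) - (u t \*: U) + (v t \*: V))
    (fun s => u (t + s) - u t * u s + v t * v s) 0 d d_ge0.
    apply: is_deriveD; first apply: is_deriveB.
    - exact: Ushift.
    - by apply: is_deriveZ; apply: UP; lra.
    - by apply: is_deriveZ; apply: VP; lra.
  rewrite uD// (_ : u t * u x - v t * v x - u t * u x + v t * v x = 0);
    last by ring.
  rewrite mul0r !fctE /= addr0 (addrC t d) /p /q /GRing.scale/=; lra.
have VE t : 0 <= t -> t <= 1 -> V (d + t) - V t = v t * p + u t * q.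
  move=> t0 t1.
  have [s s0 sd|x /andP[x0 xd]] := @increment_MVT R
    ((fun s => V (t + s)) - (v t \*: U) - (u t \*: V))
    (fun s => v (t + s) - v t * u s - u t * v s) 0 d d_ge0.
    apply: is_deriveB; first apply: is_deriveB.
    - exact: Vshift.
    - by apply: is_deriveZ; apply: UP; lra.
    - by apply: is_deriveZ; apply: VP; lra.
  rewrite vD// (_ : v t * u x + u t * v x - v t * u x - u t * v x = 0);
    last by ring.
  rewrite mul0r !fctE /= addr0 (addrC t d) /p /q /GRing.scale/=; lra.
(* Division by p + i q expresses u and v through the differentiable functions
   J1 and J2. *)
pose D := p ^+ 2 + q ^+ 2.
have D_gt0 : 0 < D by rewrite ltr_wpDr ?sqr_ge0// exprn_gt0.
pose J1 t := U (d + t) - U t; pose J2 t := V (d + t) - V t.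
have J1d : is_derive (0 : R) 1 J1 (u (d + 0) - u 0).
  by apply: is_deriveB; [apply: Ushift|apply: UP]; lra.
have J2d : is_derive (0 : R) 1 J2 (v (d + 0) - v 0).
  by apply: is_deriveB; [apply: Vshift|apply: VP]; lra.
have [a G1d] : exists a, is_derive (0 : R) 1 (D^-1 \*: (p \*: J1 + q \*: J2)) a.
  by eexists; apply: is_deriveZ; apply: is_deriveD; exact: is_deriveZ.
have [b G2d] : exists b, is_derive (0 : R) 1 (D^-1 \*: (p \*: J2 - q \*: J1)) b.
  by eexists; apply: is_deriveZ; apply: is_deriveB; exact: is_deriveZ.
have uG h : 0 <= h -> h <= 1 -> u h = D^-1 * (p * J1 h + q * J2 h).
  move=> h0 h1; rewrite /J1 /J2 UE// VE//.
  by rewrite /D; field; rewrite gt_eqF.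
have vG h : 0 <= h -> h <= 1 -> v h = D^-1 * (p * J2 h - q * J1 h).
  move=> h0 h1; rewrite /J1 /J2 UE// VE//.
  by rewrite /D; field; rewrite gt_eqF.
exists a, b; split.
  apply: cvg_trans (is_derive_cvg_right G1d).
  apply: near_eq_cvg; near=> h.
  have h_ge0 : 0 <= h by [].
  have h_le1 : h <= 1 by near: h; apply: nbhs_right_le; exact: ltr01.
  by rewrite -u0 !uG.
apply: cvg_trans (is_derive_cvg_right G2d).
apply: near_eq_cvg; near=> h.
have h_ge0 : 0 <= h by [].
have h_le1 : h <= 1 by near: h; apply: nbhs_right_le; exact: ltr01.
by rewrite -[v h]subr0 -[in RHS]v0 !vG.
Unshelve. all: by end_near. Qed.

(** * Attainment of the growth bound *)

Lemma complex_line_inj (R : realType) (B : normedModType R)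
  (w : complexification B) : w != 0 -> injective (fun a : R[i] => a *: w).
Proof.
move=> /cnorm_gt0 w_gt0 a b /eqP; rewrite -subr_eq0 -scalerBl => /eqP ab.
have := ler_normc_cnorm (a - b) w.
rewrite ab cnorm0 mulr0 pmulr_lle0// => n_le0.
apply/eqP; rewrite -subr_eq0; apply/eqP/eq0_normc/le_anti.
by rewrite n_le0 normc_ge0.
Qed.

Section Eigenvalue.
Variables (R : realType) (B : completeNormedModType R) (T : R -> B -> B).
Hypothesis T_semigroup : C0_semigroup T.

(** On the line spanned by [w] the semigroup acts by a continuous character,
    whose derivative at 0 is the eigenvalue. *)
Lemma eigenvector_of_invariant_line (w : complexification B) : cnorm w = 1 ->
  (forall t, 0 <= t -> exists c : R[i], cmap (T t) w = c *: w) ->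
  exists l, eigenvector T l w.
Proof.
move=> w1 inv.
have w_neq0 := cnorm1_neq0 w1.
have inj := complex_line_inj w_neq0.
have max_ge0 (t : R) : 0 <= Num.max t 0 by rewrite le_max lexx orbT.
have [c cP] := choice (fun t => inv (Num.max t 0) (max_ge0 t)).
have cE t : 0 <= t -> cmap (T t) w = c t *: w.
  by move=> t_ge0; rewrite -cP max_l.
have c0 : c 0 = 1.
  by apply: inj; rewrite -cE// (csemigroup0 T_semigroup) scale1r.
have cD s t : 0 <= s -> 0 <= t -> c (s + t) = c s * c t.
  move=> s0 t0; apply: inj; rewrite -cE ?addr_ge0// (csemigroupD T_semigroup)//.
  by rewrite (cE t)// (csemigroupZ T_semigroup)// cE// scalerA mulrC.
have orbit_dist t : 2 * cnorm (cmap (T (Num.max t 0)) w -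
    cmap (T (Num.max s 0)) w) @[s --> t] --> (0 : R).
  have orbB x : `|T (Num.max t 0) x - T (Num.max s 0) x| @[s --> t] --> (0 : R).
    have : T (Num.max t 0) x - T (Num.max s 0) x @[s --> t] --> (0 : B).
      rewrite -(subrr (T (Num.max t 0) x)); apply: cvgB; first exact: cvg_cst.
      exact: (orbit_continuous T_semigroup).
    by move=> /cvg_norm; rewrite normr0.
  rewrite -[X in _ --> X](mulr0 2); apply: cvgM; first exact: cvg_cst.
  rewrite -[X in _ --> X](addr0 (0 : R)).
  exact: (cvgD (orbB w.1) (orbB w.2)).
have c_dist t s : normc (c t - c s) <=
    2 * cnorm (cmap (T (Num.max t 0)) w - cmap (T (Num.max s 0)) w).
  by have := ler_normc_cnorm (c t - c s) w; rewrite w1 mulr1 scalerBl -!cP.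
have part_cont (f : R[i] -> R) : {morph f : a b / a - b} ->
    (forall a, `|f a| <= normc a) -> continuous (f \o c).
  move=> fB f_le t; apply/cvgrPdist_lt => e e_gt0.
  apply: filterS (cvgr0_norm_lt _ (orbit_dist t) _ e_gt0) => s.
  rewrite ger0_norm ?mulr_ge0 ?cnorm_ge0// => lt_e; apply: le_lt_trans lt_e.
  by rewrite /= -fB; exact: le_trans (f_le _) (c_dist t s).
have [||||||a [b [aP bP]]] := @complex_character_right_derivable R
  (fun t => complex.Re (c t)) (fun t => complex.Im (c t)).
- by apply: part_cont; [case=> ? ? [? ?]|exact: normr_Re_le].
- by apply: part_cont; [case=> ? ? [? ?]|exact: normr_Im_le].
- by rewrite c0.
- by rewrite c0.
- by move=> s t s0 t0; rewrite cD//; case: (c s) (c t) => ? ? [? ?].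
- move=> s t s0 t0; rewrite cD//; case: (c s) (c t) => ? ? [? ?] /=.
  exact: addrC.
exists (Complex a b).
case: w {w1 inv w_neq0 inj cP c0 orbit_dist c_dist part_cont} cE => x y cE.
split=> /=.
  have lim : ((complex.Re (c h) - 1) / h) *: x - (complex.Im (c h) / h) *: y
      @[h --> 0^'+] --> a *: x - b *: y.
    by apply: cvgB; exact: cvgZr_tmp.
  apply: cvg_trans lim; apply: near_eq_cvg; near=> h.
  have h_ge0 : 0 <= h by [].
  have [-> _] := cE h h_ge0; rewrite ![_ / h]mulrC -!scalerA -scalerBr.
  by rewrite scalerBl scale1r addrAC.
have lim : ((complex.Re (c h) - 1) / h) *: y + (complex.Im (c h) / h) *: x
    @[h --> 0^'+] --> a *: y + b *: x.
  by apply: cvgD; exact: cvgZr_tmp.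
apply: cvg_trans lim; apply: near_eq_cvg; near=> h.
have h_ge0 : 0 <= h by [].
have [_ ->] := cE h h_ge0; rewrite ![_ / h]mulrC -!scalerA -scalerDr.
by rewrite scalerBl scale1r addrAC.
Unshelve. all: by end_near. Qed.

(** With [Re_eigenvalue_le_growth_exponent], this says that the growth bound is
    the real part of an eigenvalue of the generator. The scalar by which [T_t0]
    acts on the common eigenvector is [exp (l t0)], which gives the bound on
    [Re l]. *)
Lemma peripheral_eigenvalue t0 : 0 < t0 -> compact_operator (T t0) ->
  has_lbound (growth_exponents T) ->
  exists l z, [/\ z != 0, eigenvector T l z &
    inf (growth_exponents T) <= complex.Re l].
Proof.
move=> t0_gt0 T_compact lb.
have [k [z [k_le z1 zk]]] :=
  peripheral_eigenvector T_semigroup t0_gt0 lb T_compact.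
have z_neq0 := cnorm1_neq0 z1.
have [k' [w [k'k w1 wk inv]]] :=
  common_eigenvector T_semigroup t0_gt0 T_compact z_neq0 zk.
have [l wl] := eigenvector_of_invariant_line w1 inv.
have w_neq0 := cnorm1_neq0 w1.
exists l, w; split => //.
have wE : (k' * cexp l t0) *: w = w.
  by rewrite -scalerA -(eigenvector_orbit T_semigroup wl (ltW t0_gt0)) -wk.
have k'_inv : normc k' * expR (complex.Re l * t0) = 1.
  rewrite -normc_cexp -normcM; suff -> : k' * cexp l t0 = 1 by exact: normc1.
  by apply: (complex_line_inj w_neq0); rewrite wE scale1r.
rewrite -(ler_pM2r t0_gt0) -lerN2 -ler_expR.
apply: le_trans (le_trans k'k k_le).
by rewrite expRN -(mulfK (_ : expR (complex.Re l * t0) != 0) (normc k'))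
  ?k'_inv ?mul1r// gt_eqF// expR_gt0.
Qed.

End Eigenvalue.

Theorem corollary8 (R : realType) (B : completeNormedModType R)
  (T : R -> B -> B) (r : R)
  (T_semigroup : C0_semigroup T)
  (T_compact : forall t : R, 0 <= t -> r <= t -> compact_operator (T t))
  (spectrum_lt0 :
    forall l, point_spectrum (generator T) l -> complex.Re l < 0) :
  exists lambda1 : \bar R,
    [/\ is_emax [set complex.Re l | l in point_spectrum (generator T)] lambda1,
        (lambda1 < 0)%E
      & forall xi : B,
          (limf_esup (fun t : R => (t^-1)%:E * lne (`|T t xi|)%:E)
                     (pinfty_nbhs R) <= lambda1)%E].
Proof.
have W_neq0 := growth_exponents_nonempty T_semigroup.
have Re_le l w : point_spectrum (generator T) l -> growth_exponents T w ->
    complex.Re l <= w.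
  move=> /(point_spectrumP T_semigroup)[z z_neq0 zl].
  exact: (Re_eigenvalue_le_growth_exponent T_semigroup zl).
have [lb|nlb] := pselect (has_lbound (growth_exponents T)); last first.
  exists -oo%E; split; [left; split => //|by []|move=> xi].
    rewrite -subset0 => a [l lP _]; apply: nlb.
    by exists (complex.Re l) => w; exact: Re_le.
  rewrite leeNy_eq; apply/eqP/eq_ninfty => A.
  have [w ww wA] : exists2 w, growth_exponents T w & w < A.
    apply: contrapT => nw; apply: nlb; exists A => w ww.
    by rewrite leNgt; apply/negP => wA; apply: nw; exists w.
  by apply: le_trans (limf_esup_le_growth_exponent _ ww) _; rewrite lee_fin ltW.
have t0_gt0 : 0 < Num.max r 1 by rewrite lt_max ltr01 orbT.
have t0_compact : compact_operator (T (Num.max r 1)).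
  by apply: T_compact; [exact: ltW|rewrite le_max lexx].
have [l [z [z_neq0 zl l_ge]]] :=
  peripheral_eigenvalue T_semigroup t0_gt0 t0_compact lb.
have lP : point_spectrum (generator T) l.
  by apply/(point_spectrumP T_semigroup); exists z.
exists (complex.Re l)%:E; split; first right.
- exists (complex.Re l) => //; split; first by exists l.
  move=> _ [l' l'P <-]; apply: le_trans l_ge.
  by apply: lb_le_inf => // w; exact: Re_le.
- by rewrite lte_fin spectrum_lt0.
move=> xi; apply/lee_addgt0Pr => e e_gt0.
have [w ww wlt] := inf_adherent e_gt0 (conj W_neq0 lb).
apply: le_trans (limf_esup_le_growth_exponent _ ww) _.
by rewrite -EFinD lee_fin ltW// (lt_le_trans wlt)// lerD2r.
Qed.
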